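(* Let $\pi_0\in P(3,3)$ be the partition with blocks $\{1,2,2',3'\}$ and $\{3,1'\}$ (upper points $1,2,3$, lower points $1',2',3'$, numbered from left to right). There is a one-to-one correspondence between - categories of partitions which contain $\pi_0$, and - strongly symmetric reflection groups on countably many generators (i.e. quotients of $\mathbb{Z}_2^{*\infty}$ by $\mathrm{sS}_\infty$-invariant normal subgroups, together with their natural generators). It is given by associating $\mathbb{Z}_2^{*\infty}/F_\infty(\mathcal{C})$ with a category of partitions $\mathcal{C}$.
   Context: Partitions: $P(k,l)$ is the set of set partitions (into blocks) of $k$ upper and $l$ lower points, each row ordered from left to right. Operations: tensor product (juxtaposition); composition $qp\in P(k,m)$ for $p\in P(k,l)$, $q\in P(l,m)$ (put $p$ above $q$, join along the $l$ middle points, delete the middle points and any blocks contained in them); involution (turn upside down); rotation (moving the leftmost, or rightmost, point of one row to the leftmost, resp. rightmost, position of the other row, keeping blocks). A category of partitions $\mathcal{C}$ is a collection of subsets $\mathcal{C}(k,l)\subset P(k,l)$, $k,l\ge0$, closed under these operations and containing the one-block pair partition on two points. Write $\mathcal{C}(k)=\mathcal{C}(k,0)$ for the partitions in $\mathcal{C}$ with $k$ upper and no lower points. $\mathbb{Z}_2^{*\infty}$ is the free product of countably infinitely many copies of $\mathbb{Z}/2\mathbb{Z}$ with canonical generators $a_1,a_2,\dots$. For a partition $p$ of $k$ points, a labelling $i=(i_1,\dots,i_k)$ by positive integers is compatible if it is constant on each block of $p$; then $w(p,i)=a_{i_1}a_{i_2}\cdots a_{i_k}\in\mathbb{Z}_2^{*\infty}$.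 Put $$F_\infty(\mathcal{C})=\{w(p,i) : k\in\mathbb{N},\ p\in\mathcal{C}(k),\ i \text{ a compatible labelling of } p \text{ by positive integers}\},$$ which is a normal subgroup of $\mathbb{Z}_2^{*\infty}$. $\mathrm{sS}_\infty$ is the semigroup of all endomorphisms $\sigma_\phi:a_k\mapsto a_{\phi(k)}$ of $\mathbb{Z}_2^{*\infty}$, where $\phi$ is any map from the positive integers to themselves; a subgroup $N$ is $\mathrm{sS}_\infty$-invariant if $\sigma_\phi(N)\subset N$ for all $\phi$. Strongly symmetric reflection groups are considered together with their generators, so they correspond to the $\mathrm{sS}_\infty$-invariant normal subgroups themselves. *)

(* Defs.v *)
(* MathComp, with the classical axioms of mathcomp.classical.boolp *)
From HB Require Import structures.
From mathcomp Require Import all_boot.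
From mathcomp Require Import generic_quotient boolp.

Set Implicit Arguments.
Unset Strict Implicit.
Unset Printing Implicit Defensive.

Local Open Scope group_scope.

(* [inl] is the upper row and [inr] the lower one; positions start at 0 *)
Notation points k l := ('I_k + 'I_l)%type.

Definition partitions (k l : nat) : {set {set {set points k l}}} :=
  [set p | partition p [set: points k l]].

Definition relabel (X Y : finType) (f : X -> Y) (p : {set {set X}}) :
  {set {set Y}} := [set f @: (B : {set X}) | B in p].

Definition tensorl k l k' l' (x : points k l) : points (k + k') (l + l') :=
  match x with inl i => inl (lshift k' i) | inr j => inr (lshift l' j) end.

Definition tensorr k l k' l' (x : points k' l') : points (k + k') (l + l') :=
  match x with inl i => inl (rshift k i) | inr j => inr (rshift l j) end.

Definition tensor k l k' l' (p : {set {set points k l}})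
    (q : {set {set points k' l'}}) : {set {set points (k + k') (l + l')}} :=
  relabel (@tensorl k l k' l') p :|: relabel (@tensorr k l k' l') q.

Definition stack k l m := (('I_k + 'I_l) + 'I_m)%type.

Definition stack_top k l m (x : points k l) : stack k l m := inl x.

Definition stack_bot k l m (x : points l m) : stack k l m :=
  match x with inl i => inl (inr i) | inr j => inr j end.

Definition stack_outer k l m (x : points k m) : stack k l m :=
  match x with inl i => inl (inl i) | inr j => inr j end.

Definition same_block (X : finType) (p : {set {set X}}) : rel X :=
  fun x y => [exists B in p, (x \in B) && (y \in B)].

Definition glue k l m (q : {set {set points l m}}) (p : {set {set points k l}}) :
    {set {set stack k l m}} :=
  equivalence_partition
    (connect (same_block
       (relabel (@stack_top k l m) p :|: relabel (@stack_bot k l m) q)))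
    [set: stack k l m].

(* the blocks of the glued partition that lie entirely in the middle row have
   an empty trace on the outer rows *)
Definition compose k l m (q : {set {set points l m}}) (p : {set {set points k l}}) :
    {set {set points k m}} :=
  [set @stack_outer k l m @^-1: (B : {set stack k l m}) | B in glue q p] :\ set0.

Definition flip k l (x : points k l) : points l k :=
  match x with inl i => inr i | inr j => inl j end.

Definition involution k l (p : {set {set points k l}}) :
  {set {set points l k}} := relabel (@flip k l) p.

(* moves the upper point [h] to position [h'] of the lower row *)
Definition move_down k l (h : 'I_k.+1) (h' : 'I_l.+1) (x : points k.+1 l) :
    points k l.+1 :=
  match x with
  | inl i => if unlift h i is Some i' then inl i' else inr h'
  | inr j => inr (lift h' j)
  end.

(* moves the lower point [h'] to position [h] of the upper row *)
Definition move_up k l (h : 'I_k.+1) (h' : 'I_l.+1) (x : points k l.+1) :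
    points k.+1 l :=
  match x with
  | inl i => inl (lift h i)
  | inr j => if unlift h' j is Some j' then inr j' else inl h
  end.

(* [cat_pair] has both points in the upper row; its rotations give the pair
   partitions in P(1,1) and P(0,2) *)
Record category_of_partitions := CategoryOfPartitions {
  cat_hom :> forall k l : nat, {set {set {set points k l}}};
  cat_sub : forall k l, cat_hom k l \subset partitions k l;
  cat_tensor : forall k l k' l' p q,
    p \in cat_hom k l -> q \in cat_hom k' l' ->
    tensor p q \in cat_hom (k + k') (l + l');
  cat_compose : forall k l m p q,
    p \in cat_hom k l -> q \in cat_hom l m -> compose q p \in cat_hom k m;
  cat_involution : forall k l p,
    p \in cat_hom k l -> involution p \in cat_hom l k;
  cat_rot_left_down : forall k l p, p \in cat_hom k.+1 l ->
    relabel (@move_down k l ord0 ord0) p \in cat_hom k l.+1;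
  cat_rot_right_down : forall k l p, p \in cat_hom k.+1 l ->
    relabel (@move_down k l ord_max ord_max) p \in cat_hom k l.+1;
  cat_rot_left_up : forall k l p, p \in cat_hom k l.+1 ->
    relabel (@move_up k l ord0 ord0) p \in cat_hom k.+1 l;
  cat_rot_right_up : forall k l p, p \in cat_hom k l.+1 ->
    relabel (@move_up k l ord_max ord_max) p \in cat_hom k.+1 l;
  cat_pair : [set [set: points 2 0]] \in cat_hom 2 0
}.

Definition pi0 : {set {set points 3 3}} :=
  let up i : points 3 3 := inl (inord i) in
  let low i : points 3 3 := inr (inord i) in
  [set [set up 0%N; up 1%N; low 1%N; low 2%N]; [set up 2%N; low 0%N]].

(* Z_2^{*oo}, realised on the words in the letters 0, 1, 2, ... without two
   equal neighbours, multiplied by concatenation and cancellation *)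

Definition reduced (s : seq nat) := sorted (fun x y => x != y) s.

Definition push (x : nat) (s : seq nat) : seq nat :=
  if s is y :: s' then if x == y then s' else x :: s else [:: x].

Lemma push_reduced x s : reduced s -> reduced (push x s).
Proof.
case: s => [//|y s] /=; case: eqP => [_ /path_sorted //|/eqP neq_xy].
by rewrite /= neq_xy.
Qed.

Lemma pushK x s : reduced s -> push x (push x s) = s.
Proof.
case: s => [_ /=|y s]; first by rewrite eqxx.
rewrite /=; case: eqP => [<-|_ _] /=; last by rewrite eqxx.
by case: s => [//|z s] /= /andP[/negPf-> _].
Qed.

Lemma push_path x s : path (fun x y => x != y) x s -> push x s = x :: s.
Proof. by case: s => [//|y s] /= /andP[/negPf->]. Qed.

Lemma foldr_push_reduced s t : reduced t -> reduced (foldr push t s).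
Proof. by move=> rt; elim: s => //= x s; apply: push_reduced. Qed.

Record Z2inf := MkZ2inf { word : seq nat; _ : reduced word }.

HB.instance Definition _ := [isSub for word].
HB.instance Definition _ := [Choice of Z2inf by <:].

Lemma word_reduced (u : Z2inf) : reduced (word u).
Proof. by case: u. Qed.

Definition Z2inf_one : Z2inf := MkZ2inf (isT : reduced [::]).

Definition Z2inf_mul (u v : Z2inf) : Z2inf :=
  MkZ2inf (foldr_push_reduced (word u) (word_reduced v)).

Lemma rev_reduced (u : Z2inf) : reduced (rev (word u)).
Proof.
rewrite /reduced rev_sorted; have := word_reduced u.
by congr (is_true _); case: (word u) => //= x s; apply: eq_path => y z; rewrite eq_sym.
Qed.

Definition Z2inf_inv (u : Z2inf) : Z2inf := MkZ2inf (rev_reduced u).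

Lemma Z2inf_mulA : associative Z2inf_mul.
Proof.
move=> u v w; apply: val_inj => /=.
elim: (word u) => //= x s ->.
have: reduced (foldr push (word v) s) by apply/foldr_push_reduced/word_reduced.
case: (foldr push (word v) s) => [//|y t] /= r_yt.
case: eqP => [->|//] /=.
by rewrite pushK //; apply/foldr_push_reduced/word_reduced.
Qed.

Lemma Z2inf_mul1 : left_id Z2inf_one Z2inf_mul.
Proof. by move=> u; apply: val_inj. Qed.

Lemma Z2inf_mulr1 : right_id Z2inf_one Z2inf_mul.
Proof.
move=> u; apply: val_inj => /=; have := word_reduced u; rewrite /reduced.
elim: (word u) => //= x s IH r_xs.
by rewrite IH ?(path_sorted r_xs) // push_path.
Qed.

Lemma Z2inf_mulV : left_inverse Z2inf_one Z2inf_inv Z2inf_mul.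
Proof.
move=> u; apply: val_inj => /=; elim: (word u) => //= x s IH.
by rewrite rev_cons -cats1 foldr_cat /= eqxx.
Qed.

Lemma Z2inf_invK : involutive Z2inf_inv.
Proof. by move=> u; apply: val_inj; rewrite /= revK. Qed.

Lemma Z2inf_mulrV : right_inverse Z2inf_one Z2inf_inv Z2inf_mul.
Proof. by move=> u; rewrite -{1}(Z2inf_invK u) Z2inf_mulV. Qed.

HB.instance Definition _ := isGroup.Build Z2inf
  Z2inf_mulA Z2inf_mul1 Z2inf_mulr1 Z2inf_mulV Z2inf_mulrV.

Definition gen (i : nat) : Z2inf := MkZ2inf (isT : reduced [:: i]).

Lemma gen_inv i : (gen i)^-1 = gen i. Proof. exact: val_inj. Qed.

Lemma genK i : gen i * gen i = 1.
Proof. by rewrite -{1}gen_inv mulVg. Qed.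

Lemma Z2inf_prod (u : Z2inf) : u = \prod_(i <- word u) gen i.
Proof.
apply: val_inj => /=; have := word_reduced u; rewrite /reduced.
elim: (word u) => [|x s IH] r_xs /=; first by rewrite big_nil.
by rewrite big_cons /= -IH ?(path_sorted r_xs) //= push_path.
Qed.

Definition Z2inf_lift (G : groupType) (f : nat -> G) (u : Z2inf) : G :=
  \prod_(i <- word u) f i.

(* universal property of the free product of copies of Z/2Z *)
Lemma Z2inf_liftP (G : groupType) (f : nat -> G) :
  (forall i, f i * f i = 1) ->
  [/\ {morph Z2inf_lift f : u v / u * v},
      forall i, Z2inf_lift f (gen i) = f i
    & forall h : Z2inf -> G, {morph h : u v / u * v} ->
        (forall i, h (gen i) = f i) -> h =1 Z2inf_lift f].
Proof.
move=> ff1; split=> [u v|i|h hM hgen u].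
- rewrite /Z2inf_lift /=; elim: (word u) => [|x s IH].
    by rewrite big_nil mul1g.
  rewrite big_cons -mulgA -IH /=.
  case: (foldr push (word v) s) => [|y t]; first by rewrite big_cons.
  rewrite /=; case: eqP => [->|_]; last by rewrite big_cons.
  by rewrite big_cons mulgA ff1 mul1g.
- by rewrite /Z2inf_lift /= big_seq1.
- rewrite [in LHS](Z2inf_prod u) /Z2inf_lift.
  elim: (word u) => [|x s IH]; last by rewrite !big_cons hM hgen IH.
  by rewrite !big_nil; apply: (@mulgI _ (h 1)); rewrite -hM !mulg1.
Qed.

Definition sS_endo (phi : nat -> nat) : Z2inf -> Z2inf :=
  Z2inf_lift (fun i => gen (phi i)).

Definition sS_invariant (N : {pred Z2inf}) : Prop :=
  forall phi : nat -> nat, {in N, forall u, sS_endo phi u \in N}.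

Record normal_subgroup (G : groupType) := NormalSubgroup {
  nsg_pred :> {pred G};
  nsg_group : group_closed nsg_pred;
  nsg_normal : forall x y, x \in nsg_pred -> x ^ y \in nsg_pred
}.

Section Quotient.
Variables (G : groupType) (N : normal_subgroup G).

Definition coset_rel : rel G := fun x y => x^-1 * y \in nsg_pred N.

Let N1 : 1 \in nsg_pred N. Proof. by case: (nsg_group N). Qed.
Let NM x y : x \in nsg_pred N -> y \in nsg_pred N -> x * y \in nsg_pred N.
Proof. exact: (group_closedM (nsg_group N)). Qed.
Let NV x : x \in nsg_pred N -> x^-1 \in nsg_pred N.
Proof. exact: (group_closedV (nsg_group N)). Qed.

Lemma coset_rel_refl : reflexive coset_rel.
Proof. by move=> x; rewrite /coset_rel mulVg N1. Qed.

Lemma coset_rel_sym : symmetric coset_rel.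
Proof.
by move=> x y; rewrite /coset_rel; apply/idP/idP => /NV; rewrite invgM invgK.
Qed.

Lemma coset_rel_trans : transitive coset_rel.
Proof.
move=> y x z; rewrite /coset_rel => xy yz.
by have := NM xy yz; rewrite -mulgA mulVKg.
Qed.

Canonical coset_equiv :=
  EquivRel coset_rel coset_rel_refl coset_rel_sym coset_rel_trans.

Definition quotient_group := {eq_quot coset_equiv}%qT.

HB.instance Definition _ := Choice.on quotient_group.

Definition quotient_map (x : G) : quotient_group := (\pi_{eq_quot coset_equiv} x)%qT.

Lemma quotient_mapE x y :
  (quotient_map x = quotient_map y) <-> (x^-1 * y \in nsg_pred N).
Proof.
split=> [/eqP|xy]; first by rewrite /quotient_map eqmodE.
by apply/eqP; rewrite /quotient_map eqmodE.
Qed.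

Lemma quotient_map_repr (a : quotient_group) : quotient_map (repr a) = a.
Proof. exact: reprK. Qed.

Definition quotient_one : quotient_group := quotient_map 1.
Definition quotient_inv (a : quotient_group) := quotient_map (repr a)^-1.
Definition quotient_mul (a b : quotient_group) := quotient_map (repr a * repr b).

Lemma quotient_mapM x y :
  quotient_map (x * y) = quotient_mul (quotient_map x) (quotient_map y).
Proof.
apply/quotient_mapE.
have /quotient_mapE xr := esym (quotient_map_repr (quotient_map x)).
have /quotient_mapE yr := esym (quotient_map_repr (quotient_map y)).
have := NM (nsg_normal y xr) yr.
by rewrite /conjg invgM !mulgA -[_ * y * y^-1]mulgA mulgV mulg1.
Qed.

Lemma quotient_mapV x : quotient_map x^-1 = quotient_inv (quotient_map x).
Proof.
apply/quotient_mapE.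
have /quotient_mapE /(nsg_normal x^-1) := quotient_map_repr (quotient_map x).
by rewrite /conjg invgK -!mulgA mulgV mulg1.
Qed.

Lemma quotient_mulA : associative quotient_mul.
Proof.
move=> a b c; rewrite -(quotient_map_repr a) -(quotient_map_repr b).
by rewrite -(quotient_map_repr c) -!quotient_mapM mulgA.
Qed.

Lemma quotient_mul1 : left_id quotient_one quotient_mul.
Proof. by move=> a; rewrite -(quotient_map_repr a) -quotient_mapM mul1g. Qed.

Lemma quotient_mulr1 : right_id quotient_one quotient_mul.
Proof. by move=> a; rewrite -(quotient_map_repr a) -quotient_mapM mulg1. Qed.

Lemma quotient_mulV : left_inverse quotient_one quotient_inv quotient_mul.
Proof.
by move=> a; rewrite -(quotient_map_repr a) -quotient_mapV -quotient_mapM mulVg.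
Qed.

Lemma quotient_mulrV : right_inverse quotient_one quotient_inv quotient_mul.
Proof.
by move=> a; rewrite -(quotient_map_repr a) -quotient_mapV -quotient_mapM mulgV.
Qed.

HB.instance Definition _ := isGroup.Build quotient_group
  quotient_mulA quotient_mul1 quotient_mulr1 quotient_mulV quotient_mulrV.

End Quotient.

(* a group together with a sequence of elements (its generators below) *)
Record marked_group := MarkedGroup {
  mg_group :> groupType;
  mg_gen : nat -> mg_group
}.

Definition marked_iso (G H : marked_group) : Prop :=
  exists f : G -> H,
    [/\ bijective f, {morph f : x y / x * y} & forall i, f (mg_gen G i) = mg_gen H i].

Definition Z2inf_quotient (N : normal_subgroup Z2inf) : marked_group :=
  MarkedGroup (fun i => quotient_map N (gen i)).

Definition strongly_symmetric_reflection_group (G : marked_group) : Prop :=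
  exists N : normal_subgroup Z2inf, sS_invariant N /\ marked_iso G (Z2inf_quotient N).

Definition compatible (X : finType) (p : {set {set X}}) (i : X -> nat) : Prop :=
  forall B x y, B \in p -> x \in B -> y \in B -> i x = i y.

Definition label_word k (i : points k 0 -> nat) : Z2inf :=
  \prod_(j < k) gen (i (inl j)).

Definition F_inf (C : category_of_partitions) : {pred Z2inf} := fun u =>
  `[< exists (k : nat) (p : {set {set points k 0}}) (i : points k 0 -> nat),
        [/\ p \in C k 0, compatible p i & u = label_word i] >].

Section FInfNormal.
Variable C : category_of_partitions.

Lemma F_infP u : reflect (exists k p (i : points k 0 -> nat),
  [/\ p \in C k 0, compatible p i & u = label_word i]) (u \in F_inf C).
Proof. exact: asboolP. Qed.

Lemma compatible_relabel (X Y : finType) (h : X -> Y) p (i : X -> nat) i' :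
  compatible p i -> i =1 i' \o h -> compatible (relabel h p) i'.
Proof.
move=> ip ii' _ _ _ /imsetP[B Bp ->] /imsetP[x xB ->] /imsetP[y yB ->].
by rewrite -!(ii' _ : i _ = i' (h _)); apply: (ip B).
Qed.

Lemma compatibleU (X : finType) (p q : {set {set X}}) i :
  compatible p i -> compatible q i -> compatible (p :|: q) i.
Proof. by move=> ip iq B x y /setUP[]; [apply: ip | apply: iq]. Qed.

(* moving all lower points to the upper row, from the right *)
Lemma F_inf_rotate k l p (i : points k l -> nat) :
  p \in C k l -> compatible p i ->
  (\prod_(j < k) gen (i (inl j))) * (\prod_(j < l) gen (i (inr j)))^-1 \in F_inf C.
Proof.
elim: l k p i => [|l IH] k p i pC ip.
  rewrite [X in _ * X^-1]big_ord0 invg1 mulg1.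
  by apply/F_infP; exists k, p, i.
pose i' (x : points k.+1 l) := match x with
  | inl a => if unlift ord_max a is Some b then i (inl b) else i (inr ord_max)
  | inr b => i (inr (lift ord_max b)) end.
have ip' : compatible (relabel (@move_up k l ord_max ord_max) p) i'.
  apply: compatible_relabel ip _ => -[a|b] /=; first by rewrite liftK.
  by case: unliftP => [b' ->|->] //=; rewrite unlift_none.
have := IH _ _ _ (cat_rot_right_up pC) ip'.
rewrite !big_ord_recr /= unlift_none invgM gen_inv mulgA.
have liftE n (j : 'I_n) : widen_ord (leqnSn n) j = lift ord_max j.
  by apply: val_inj; rewrite /= /bump leqNgt ltn_ord.
under eq_bigr do rewrite liftE liftK.
by under [X in _ -> _ * X^-1 \in _]eq_bigr do rewrite liftE.
Qed.

Lemma F_infM : mulg_closed (F_inf C).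
Proof.
move=> u v /F_infP[k [p [i [pC ip ->]]]] /F_infP[k' [p' [i' [p'C ip' ->]]]].
pose j (x : points (k + k') 0) : nat := match x with
  | inl a => match split a with inl b => i (inl b) | inr b => i' (inl b) end
  | inr b => 0 end.
have jl a : j (inl (lshift k' a)) = i (inl a).
  by rewrite /j (unsplitK (inl a)).
have jr a : j (inl (rshift k a)) = i' (inl a).
  by rewrite /j (unsplitK (inr a)).
apply/F_infP; exists (k + k'), (@tensor k 0 k' 0 p p'), j; split.
- exact: (@cat_tensor C k 0 k' 0).
- apply: compatibleU.
    by apply: compatible_relabel ip _ => -[a|[]//]; rewrite -jl.
  by apply: compatible_relabel ip' _ => -[a|[]//]; rewrite -jr.
- by rewrite /label_word big_split_ord; congr (_ * _); apply: eq_bigr => a _;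
    rewrite (jl, jr).
Qed.

Lemma F_infV : invg_closed (F_inf C).
Proof.
move=> u /F_infP[k [p [i [pC ip ->]]]].
have ip' : compatible (involution p) (i \o @flip 0 k).
  by apply: compatible_relabel ip _ => -[a|[]].
by have := F_inf_rotate (cat_involution pC) ip'; rewrite big_ord0 mul1g.
Qed.

Lemma F_inf1 : 1 \in F_inf C.
Proof.
have := cat_compose (cat_involution (cat_pair C)) (cat_pair C).
set p := compose _ _ => pC.
apply/F_infP; exists 0, p, (fun=> 0); split=> //.
by rewrite /label_word big_ord0.
Qed.

Lemma identity_cat : [set [set: points 1%N 1%N]] \in C 1%N 1%N.
Proof.
have := cat_rot_right_down (cat_pair C); rewrite /relabel imset_set1.
set A := (_ @: _); suff -> : A = setT by [].
apply/setP => y; rewrite inE; apply/imsetP.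
case: y => [a|b].
  by exists (inl (lift ord_max a)); rewrite // /move_down liftK.
exists (inl ord_max); rewrite // /move_down unlift_none; congr inr.
by rewrite !ord1.
Qed.

Lemma F_inf_normal x y : x \in F_inf C -> x ^ y \in F_inf C.
Proof.
rewrite (Z2inf_prod y); elim: (word y) x => [|a s IH] x xF.
  by rewrite big_nil conjg1.
rewrite big_cons conjgM; apply: IH.
case/F_infP: xF => k [p [i [pC ip ->]]].
pose j (x : points (1%N + k) (1%N + 0)) : nat := match x with
  | inl b => match split b with inl _ => a | inr b => i (inl b) end
  | inr b => a end.
have jr b : j (inl (rshift 1 b)) = i (inl b) by rewrite /j (unsplitK (inr b)).
have jl b : j (inl (lshift k b)) = a by rewrite /j (unsplitK (inl b)).
have qC := cat_tensor identity_cat pC.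
have := @F_inf_rotate _ _ _ j qC.
rewrite [X in _ * X^-1 \in _]big_ord1 big_split_ord big_ord1 jl.
rewrite /conjg mulgA [j _]/= !gen_inv.
under eq_bigr do rewrite jr.
apply; apply: compatibleU; last first.
  by apply: compatible_relabel ip _ => -[b|[]//]; rewrite -jr.
apply: (@compatible_relabel _ _ _ _ (fun=> a)) => // -[b|b] //.
by rewrite -(jl b).
Qed.

Definition F_inf_subgroup : normal_subgroup Z2inf :=
  @NormalSubgroup Z2inf (F_inf C)
    (conj F_inf1 (fun u v uF vF => F_infM uF (F_infV vF))) F_inf_normal.

End FInfNormal.

(* Main.v *)
Require Import Defs.
From mathcomp Require Import all_boot.
From mathcomp Require Import boolp.

(* A category containing [pi0] is determined by the reduced words it contains:
   label the blocks of a partition on one row by letters and read off a word.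
   Rotation and composition with a cup say that the words so obtained may be
   rotated, and that two neighbouring letters may be cancelled after being
   identified.  The partition [pi0], read along its boundary as aabaab, makes
   it possible to move a pair aa past any letter; hence any two blocks of a
   partition in the category can be merged, and pairs aa can be inserted as
   well as deleted.  So a partition lies in the category iff the element of
   the free product spelled by its word lies in the subgroup [F_inf].
   Conversely, an invariant normal subgroup N gives the category of those
   partitions all of whose labellings spell elements of N, when the lower row
   is read as an inverse. *)

Set Implicit Arguments.
Unset Strict Implicit.
Unset Printing Implicit Defensive.

Local Open Scope group_scope.

(** * Partitions as kernels of labellings by natural numbers *)

Notation kernel_partition L := (preim_partition L setT).

Section KernelPartition.
Variable X : finType.
Implicit Types (L : X -> nat) (p : {set {set X}}).

Lemma in_kernel_partition L (B : {set X}) :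
  reflect (exists x, B = [set y | L x == L y]) (B \in kernel_partition L).
Proof.
apply: (iffP imsetP) => [[x _ ->]|[x ->]].
  by exists x; apply/setP => y; rewrite !inE.
by exists x => //; apply/setP => y; rewrite !inE.
Qed.

Lemma eq_kernel_partition L L' :
  (forall x y, (L x == L y) = (L' x == L' y)) ->
  kernel_partition L = kernel_partition L'.
Proof.
by move=> LL'; apply: eq_imset => x; apply/setP => y; rewrite !inE /= LL'.
Qed.

Lemma same_block_kernel L x y :
  same_block (kernel_partition L) x y = (L x == L y).
Proof.
apply/exists_inP/eqP => [[_ /in_kernel_partition[z ->]]|Lxy].
  by rewrite !inE => /andP[/eqP<- /eqP].
exists [set z | L x == L z]; last by rewrite !inE Lxy eqxx.
by apply/in_kernel_partition; exists x.
Qed.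

(** The label of a point is the rank of its block among all sets of points. *)
Lemma partition_is_kernel p :
  partition p setT -> exists L : X -> nat, p = kernel_partition L.
Proof.
move=> pP; exists (fun x => enum_rank (pblock p x) : nat).
rewrite -[LHS](equivalence_partition_pblock pP); apply: eq_imset => x.
have /and3P[/eqP cp tp _] := pP.
apply/setP => y; rewrite !inE /= val_eqE (inj_eq enum_rank_inj).
by rewrite eq_pblock // cp inE.
Qed.

(** The point [x0] excludes an empty [X], where the kernel has no block at all. *)
Lemma const_kernel_partition (x0 : X) L :
  (forall x y, L x = L y) -> [set [set: X]] = kernel_partition L.
Proof.
move=> Lc; have fE x : [set y | L x == L y] = setT.
  by apply/setP => y; rewrite !inE (Lc x y) eqxx.
apply/setP => B; rewrite inE; apply/eqP/in_kernel_partition => [->|[x ->]] //.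
by exists x0.
Qed.

Lemma compatible_kernel L i :
  compatible (kernel_partition L) i <-> exists phi : nat -> nat, i =1 phi \o L.
Proof.
split=> [iL|[phi iE] B x y]; last first.
  by case/in_kernel_partition=> z ->; rewrite !inE !iE /= => /eqP<- /eqP<-.
(* A letter is sent to the value of [i] at any point carrying it; letters outside the image of [L]
   get the dummy value 0. *)
exists (fun n => if [pick x | L x == n] is Some x then i x else 0) => x /=.
case: pickP => [y /eqP Lyx|/(_ x)]; last by rewrite eqxx.
apply: (iL [set z | L x == L z]); rewrite ?inE ?Lyx ?eqxx //.
by apply/in_kernel_partition; exists x.
Qed.

End KernelPartition.

(** Removing the empty set discards exactly the blocks that [f] misses. With [f] the inclusion of
    the outer rows this is the last stage of [compose]. *)
Lemma preimset_kernel (X Y : finType) (f : Y -> X) (L : X -> nat) :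
  [set f @^-1: (B : {set X}) | B in kernel_partition L] :\ set0
    = kernel_partition (L \o f).
Proof.
apply/setP => B; rewrite 2!inE; apply/idP/in_kernel_partition => [/andP[B0]|[y ->]].
  case/imsetP => A /in_kernel_partition[x ->] BE.
  case/set0Pn: B0 => y; rewrite BE !inE => /eqP Lxy.
  by exists y; apply/setP => z; rewrite !inE Lxy.
apply/andP; split; first by apply/set0Pn; exists y; rewrite inE.
apply/imsetP; exists [set x | L (f y) == L x]; last by apply/setP=> z; rewrite !inE.
by apply/in_kernel_partition; exists (f y).
Qed.

Lemma relabel_kernel (X Y : finType) (f : X -> Y) g (L : X -> nat) :
  cancel f g -> cancel g f ->
  relabel f (kernel_partition L) = kernel_partition (L \o g).
Proof.
move=> fK gK; have im B : f @: B = g @^-1: B.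
  apply/setP => y; rewrite inE; apply/imsetP/idP => [[x xB ->]|yB].
    by rewrite fK.
  by exists (g y); rewrite ?gK.
apply/setP => B; apply/imsetP/in_kernel_partition => [[A]|[y ->]].
  case/in_kernel_partition=> x -> ->; exists (f x).
  by rewrite im; apply/setP => z; rewrite !inE /= fK.
exists [set x | L (g y) == L x]; last by rewrite im; apply/setP=> z; rewrite !inE.
by apply/in_kernel_partition; exists (g y).
Qed.

Lemma relabel_partition (X Y : finType) (f : X -> Y) g p :
  cancel f g -> cancel g f ->
  partition p setT -> partition (relabel f p) setT.
Proof.
move=> fK gK /partition_is_kernel[L ->].
by rewrite (relabel_kernel L fK gK) preim_partitionP.
Qed.

Lemma relabelK (X Y : finType) (f : X -> Y) g :
  cancel f g -> cancel (relabel f) (relabel g).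
Proof.
move=> fK p; rewrite /relabel -imset_comp -[RHS]imset_id; apply: eq_imset => B /=.
by rewrite -imset_comp -[RHS]imset_id; apply: eq_imset.
Qed.

(** * Rotation, tensor product and composition in terms of labellings *)

Lemma flipK k l : cancel (@flip k l) (@flip l k).
Proof. by case. Qed.

Lemma move_downK k l h h' : cancel (@move_down k l h h') (@move_up k l h h').
Proof.
case=> [i|j] /=; last by rewrite liftK.
by case: unliftP => [j ->|->] //=; rewrite unlift_none.
Qed.

Lemma move_upK k l h h' : cancel (@move_up k l h h') (@move_down k l h h').
Proof.
case=> [i|j] /=; first by rewrite liftK.
by case: unliftP => [i ->|->] //=; rewrite unlift_none.
Qed.

Lemma tensorP k l k' l' (z : points (k + k') (l + l')) :
  (exists x, z = tensorl k' l' x) \/ (exists x, z = tensorr k l x).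
Proof.
case: z => i; case: (split_ordP i) => j ->.
- by left; exists (inl j).
- by right; exists (inl j).
- by left; exists (inr j).
- by right; exists (inr j).
Qed.

(** Only the equality pattern of the letters matters, so [M] may rename those of both factors as
    long as the factors share no letter. *)
Lemma tensor_kernel k l k' l' (L : points k l -> nat)
    (L' : points k' l' -> nat) (M : points (k + k') (l + l') -> nat) :
  (forall x y, (M (tensorl k' l' x) == M (tensorl k' l' y)) = (L x == L y)) ->
  (forall x y, (M (tensorr k l x) == M (tensorr k l y)) = (L' x == L' y)) ->
  (forall x y, M (tensorl k' l' x) != M (tensorr k l y)) ->
  tensor (kernel_partition L) (kernel_partition L') = kernel_partition M.
Proof.
move=> ML ML' MLL'.
have lE x : [set tensorl k' l' y | y in [set y | L x == L y]]
    = [set z | M (tensorl k' l' x) == M z].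
  apply/setP => z; rewrite inE; apply/imsetP/idP => [[y]|].
    by rewrite inE => Lxy ->; rewrite ML.
  case: (tensorP z) => -[y ->]; last by rewrite (negPf (MLL' _ _)).
  by rewrite ML => Lxy; exists y; rewrite ?inE.
have rE x : [set tensorr k l y | y in [set y | L' x == L' y]]
    = [set z | M (tensorr k l x) == M z].
  apply/setP => z; rewrite inE; apply/imsetP/idP => [[y]|].
    by rewrite inE => Lxy ->; rewrite ML'.
  case: (tensorP z) => -[y ->]; first by rewrite eq_sym (negPf (MLL' _ _)).
  by rewrite ML' => Lxy; exists y; rewrite ?inE.
apply/setP => B; rewrite inE; apply/idP/in_kernel_partition.
  case/orP=> /imsetP[_ /in_kernel_partition[x ->] ->].
    by rewrite lE; exists (tensorl k' l' x).
  by rewrite rE; exists (tensorr k l x).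
case=> z ->; apply/orP; case: (tensorP z) => -[x ->]; [left|right]; apply/imsetP.
  exists [set y | L x == L y]; rewrite ?lE //.
  by apply/in_kernel_partition; exists x.
exists [set y | L' x == L' y]; rewrite ?rE //.
by apply/in_kernel_partition; exists x.
Qed.

Lemma tensor_partition k l k' l' p q :
  p \in partitions k l -> q \in partitions k' l' ->
  tensor p q \in partitions (k + k') (l + l').
Proof.
rewrite !inE => /partition_is_kernel[L ->] /partition_is_kernel[L' ->].
(* Even labels on the left factor and odd ones on the right keep the factors apart. *)
pose M (z : points (k + k') (l + l')) := match z with
  | inl i => match split i with inl j => (L (inl j)).*2
                              | inr j => (L' (inl j)).*2.+1 end
  | inr i => match split i with inl j => (L (inr j)).*2
                              | inr j => (L' (inr j)).*2.+1 end end.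
have Ml x : M (tensorl k' l' x) = (L x).*2.
  by case: x => j; rewrite /M /= (unsplitK (inl j)).
have Mr x : M (tensorr k l x) = (L' x).*2.+1.
  by case: x => j; rewrite /M /= (unsplitK (inr j)).
rewrite (@tensor_kernel _ _ _ _ _ _ M) ?preim_partitionP // => x y.
- by rewrite !Ml (inj_eq double_inj).
- by rewrite !Mr eqSS (inj_eq double_inj).
- rewrite Ml Mr; apply/eqP => /(congr1 odd).
  by rewrite /= !odd_double.
Qed.

Section Compose.
Variables (k l m : nat) (p : {set {set points k l}}) (q : {set {set points l m}}).

Definition stack_rel := same_block
  (relabel (@stack_top k l m) p :|: relabel (@stack_bot k l m) q).

Lemma stack_rel_top x y :
  same_block p x y -> stack_rel (stack_top m x) (stack_top m y).
Proof.
case/exists_inP => B Bp /andP[xB yB]; apply/exists_inP.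
exists (@stack_top k l m @: B); last by rewrite !imset_f.
by rewrite inE (imset_f (fun B : {set _} => _ @: B)).
Qed.

Lemma stack_rel_bot x y :
  same_block q x y -> stack_rel (stack_bot k x) (stack_bot k y).
Proof.
case/exists_inP => B Bp /andP[xB yB]; apply/exists_inP.
exists (@stack_bot k l m @: B); last by rewrite !imset_f.
by rewrite inE (imset_f (fun B : {set _} => _ @: B)) // orbT.
Qed.

Lemma stack_rel_compatible (i : stack k l m -> nat) x y :
  compatible p (i \o @stack_top k l m) -> compatible q (i \o @stack_bot k l m) ->
  stack_rel x y -> i x = i y.
Proof.
move=> ip iq /exists_inP[B /setUP[]/imsetP[A Ap ->] /andP[]] /imsetP[x' x'A ->]
  /imsetP[y' y'A ->]; [exact: (ip A) | exact: (iq A)].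
Qed.

Lemma stack_connect_sym : connect_sym stack_rel.
Proof.
apply: sym_connect_sym => x y; apply/exists_inP/exists_inP => -[B Bp];
  by rewrite andbC; exists B.
Qed.

(** Serves to show that two points are not joined: it suffices to separate them by a labelling
    compatible with both layers. *)
Lemma stack_connect_compatible (i : stack k l m -> nat) x y :
  compatible p (i \o @stack_top k l m) -> compatible q (i \o @stack_bot k l m) ->
  connect stack_rel x y -> i x = i y.
Proof.
move=> ip iq /connectP[s s_path ->]; elim: s x s_path => //= z s IH x /andP[xz zs].
by rewrite (stack_rel_compatible ip iq xz) IH.
Qed.

(** Naming a component by the rank of its canonical root makes the glued partition a kernel as
    well. *)
Definition stack_component (x : stack k l m) : nat :=
  enum_rank (fingraph.root stack_rel x).

Lemma stack_componentE x y :
  (stack_component x == stack_component y) = connect stack_rel x y.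
Proof.
by rewrite val_eqE (inj_eq enum_rank_inj) root_connect //; apply: stack_connect_sym.
Qed.

Lemma compose_kernel :
  compose q p = kernel_partition (stack_component \o @stack_outer k l m).
Proof.
rewrite -preimset_kernel.
have <-: glue q p = kernel_partition (stack_component : stack k l m -> nat).
  by apply: eq_imset => x; apply/setP => y; rewrite !inE /= stack_componentE.
by [].
Qed.

End Compose.

(** * Words spelled by labellings *)

(** The points are read around the boundary, the upper row from left to right and then the lower row
    from right to left, since inverting a product of involutions reverses it. *)
Definition partition_word k l (i : points k l -> nat) : Z2inf :=
  (\prod_(j < k) gen (i (inl j))) * (\prod_(j < l) gen (i (inr j)))^-1.

Lemma eq_partition_word k l (i i' : points k l -> nat) :
  i =1 i' -> partition_word i = partition_word i'.
Proof.
by move=> ii'; congr (_ * _^-1); apply: eq_bigr => j _; rewrite ii'.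
Qed.

Definition labelling (s t : seq nat) k l (x : points k l) : nat :=
  match x with inl i => nth 0 s i | inr j => nth 0 t j end.

Lemma pi0_kernel : pi0 = kernel_partition (@labelling [:: 0; 0; 1%N] [:: 1%N; 0; 0] 3 3).
Proof.
have nE (i j : nat) (ij : i < 3) (j3 : j < 3) :
    (Ordinal ij == inord j :> 'I_3) = (i == j) by rewrite -val_eqE /= inordK.
have lE (i j : 'I_3) : (inl i == inl j :> points 3 3) = (i == j) by [].
have rE (i j : 'I_3) : (inr i == inr j :> points 3 3) = (i == j) by [].
apply/setP => B; apply/idP/in_kernel_partition.
  rewrite !inE => /orP[]/eqP->; [exists (inl (inord 0))|exists (inl (inord 2))];
    apply/setP => -[] [[|[|[|//]]] ltx]; by rewrite !inE ?lE ?rE ?nE //= !inordK.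
case=> x ->; rewrite !inE; apply/orP; case: x => -[[|[|[|//]]] ltx];
  [left|left|right|right|left|left]; apply/eqP/setP => -[] [[|[|[|//]]] lty];
  by rewrite !inE ?lE ?rE ?nE.
Qed.

Lemma normal_subgroup_inj (G : groupType) : injective (@nsg_pred G).
Proof.
case=> [M Mgrp Mnorm] [M' M'grp M'norm] /= eqM; case: M' / eqM M'grp M'norm => *.
by congr NormalSubgroup; apply: Prop_irrelevance.
Qed.

Lemma bump_ord n (j : 'I_n) : bump n j = j.
Proof. by rewrite /bump leqNgt ltn_ord. Qed.

Lemma lift_max n (j : 'I_n) : widen_ord (leqnSn n) j = lift ord_max j.
Proof. by apply: val_inj; rewrite /= bump_ord. Qed.

Lemma big_ord_recr_lift n (i : 'I_n.+1 -> nat) :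
  \prod_(j < n.+1) gen (i j) = (\prod_(j < n) gen (i (lift ord_max j))) * gen (i ord_max).
Proof. by rewrite big_ord_recr; under eq_bigr do rewrite lift_max. Qed.

Lemma partition_setT (X : finType) (x : X) : partition [set [set: X]] setT.
Proof.
apply/and3P; split.
- by rewrite /cover big_set1.
- by apply/trivIsetP => A B; rewrite !inE => /eqP-> /eqP->; rewrite eqxx.
- by rewrite inE eq_sym; apply/set0Pn; exists x; rewrite inE.
Qed.

Lemma sS_endo_label_word (phi : nat -> nat) k (i : points k 0 -> nat) :
  sS_endo phi (label_word i) = label_word (phi \o i).
Proof.
have [M fE _] := @Z2inf_liftP Z2inf (fun i => gen (phi i)) (fun i => genK (phi i)).
rewrite /sS_endo /label_word.
apply: (big_rec2 (fun u v => Z2inf_lift _ u = v)).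
  by rewrite /Z2inf_lift big_nil.
by move=> j u v _ <-; rewrite M fE.
Qed.

Lemma label_word_nth (s : seq nat) :
  label_word (@labelling s [::] (size s) 0) = \prod_(a <- s) gen a.
Proof. by rewrite (big_nth 0) big_mkord. Qed.

(** * The category attached to a normal subgroup *)

Section GroupTheoreticalCategory.
Variable N : normal_subgroup Z2inf.

(** All compatible labellings are tested, not only the finest one, because gluing in a composition
    may identify blocks of a factor. *)
Definition category_hom k l : {set {set {set points k l}}} :=
  [set p in partitions k l |
    `[< forall i, compatible p i -> partition_word i \in nsg_pred N >]].

Lemma category_homP k l (p : {set {set points k l}}) :
  reflect (partition p setT /\ forall i, compatible p i -> partition_word i \in nsg_pred N)
          (p \in category_hom k l).
Proof.
by rewrite 2!inE; apply: (iffP andP) => -[pP /asboolP].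
Qed.

Let N1 : 1 \in nsg_pred N. Proof. by case: (nsg_group N). Qed.
Let NM x y : x \in nsg_pred N -> y \in nsg_pred N -> x * y \in nsg_pred N.
Proof. exact: (group_closedM (nsg_group N)). Qed.
Let NV x : x \in nsg_pred N -> x^-1 \in nsg_pred N.
Proof. exact: (group_closedV (nsg_group N)). Qed.

Lemma category_hom_sub k l : category_hom k l \subset partitions k l.
Proof. by apply/subsetP => p; rewrite inE => /andP[]. Qed.

Lemma category_hom_tensor k l k' l' p q :
  p \in category_hom k l -> q \in category_hom k' l' ->
  tensor p q \in category_hom (k + k') (l + l').
Proof.
move=> /category_homP[pP pN] /category_homP[qP qN]; apply/category_homP; split.
  by have := @tensor_partition k l k' l' p q; rewrite !inE; apply.
move=> i ip.
have /pN il : compatible p (i \o @tensorl k l k' l').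
  move=> B x y Bp xB yB; apply: (ip (@tensorl k l k' l' @: B)); rewrite ?imset_f //.
  by rewrite inE (imset_f (fun B : {set _} => _ @: B)).
have /qN ir : compatible q (i \o @tensorr k l k' l').
  move=> B x y Bp xB yB; apply: (ip (@tensorr k l k' l' @: B)); rewrite ?imset_f //.
  by rewrite inE (imset_f (fun B : {set _} => _ @: B)) // orbT.
(* With upper words u, u' and lower words v, v', the word u u' v'^-1 v^-1 is the conjugate u (u'
   v'^-1) u^-1 times u v^-1. *)
have := NM (nsg_normal (\prod_(j < k) gen (i (inl (lshift k' j))))^-1 ir) il.
rewrite /partition_word /conjg !big_split_ord /= invgK invgM -!mulgA.
by rewrite mulKg.
Qed.

Lemma category_hom_compose k l m p q :
  p \in category_hom k l -> q \in category_hom l m ->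
  compose q p \in category_hom k m.
Proof.
move=> /category_homP[pP pN] /category_homP[qP qN]; apply/category_homP.
rewrite compose_kernel; split; first exact: preim_partitionP.
move=> i /compatible_kernel[phi iE].
(* Since [i] factors through the components, it extends to the middle row; the two words then
   multiply and the middle parts cancel. *)
pose j := phi \o stack_component p q.
have jE x y : connect (stack_rel p q) x y -> j x = j y.
  by rewrite -stack_componentE /j => /eqP /= ->.
have /pN jp : compatible p (j \o @stack_top k l m).
  move=> B x y Bp xB yB; apply/jE/connect1/stack_rel_top.
  by apply/exists_inP; exists B; rewrite ?xB.
have /qN jq : compatible q (j \o @stack_bot k l m).
  move=> B x y Bp xB yB; apply/jE/connect1/stack_rel_bot.
  by apply/exists_inP; exists B; rewrite ?xB.
rewrite (eq_partition_word iE).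
by have := NM jp jq; rewrite /partition_word -mulgA mulKg.
Qed.

(** Covers the involution and all four rotations: only the words before and after moving the points
    remain to be compared. *)
Lemma category_hom_relabel k l k' l' (f : points k l -> points k' l') g p :
  cancel f g -> cancel g f ->
  (forall i, partition_word (i \o f) \in nsg_pred N -> partition_word i \in nsg_pred N) ->
  p \in category_hom k l -> relabel f p \in category_hom k' l'.
Proof.
move=> fK gK fN /category_homP[pP pN]; apply/category_homP; split.
  exact: relabel_partition pP.
move=> i ip; apply/fN/pN => B x y Bp xB yB; apply: (ip (f @: B)).
- by apply/imsetP; exists B.
- exact: imset_f.
- exact: imset_f.
Qed.

Lemma category_hom_involution k l p :
  p \in category_hom k l -> involution p \in category_hom l k.
Proof.
apply: category_hom_relabel => [||i /NV]; try exact: flipK.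
by rewrite /partition_word invgM invgK.
Qed.

(** A rotation on the left conjugates the word by the letter that moves, whereas one on the right
    leaves the word unchanged. *)
Lemma conj_gen a x : gen a * x * gen a \in nsg_pred N -> x \in nsg_pred N.
Proof.
move=> /(nsg_normal (gen a)).
by rewrite /conjg gen_inv -!mulgA genK mulg1 mulgA genK mul1g.
Qed.

Lemma category_hom_rot_left_down k l p : p \in category_hom k.+1 l ->
  relabel (@move_down k l ord0 ord0) p \in category_hom k l.+1.
Proof.
apply: category_hom_relabel => [||i]; [exact: move_downK|exact: move_upK|].
rewrite /partition_word !big_ord_recl /= unlift_none.
under eq_bigr do rewrite liftK.
set a := i _; set u := \prod_(_ < k) _; set v := \prod_(_ < l) _ => H.
by apply: (@conj_gen a); rewrite invgM gen_inv -!mulgA genK mulg1 mulgA.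
Qed.

Lemma category_hom_rot_right_down k l p : p \in category_hom k.+1 l ->
  relabel (@move_down k l ord_max ord_max) p \in category_hom k l.+1.
Proof.
apply: category_hom_relabel => [||i]; [exact: move_downK|exact: move_upK|].
rewrite /partition_word !(big_ord_recr_lift (_ \o _)) /= unlift_none.
under eq_bigr do rewrite liftK.
by rewrite invgM gen_inv mulgA.
Qed.

Lemma category_hom_rot_left_up k l p : p \in category_hom k l.+1 ->
  relabel (@move_up k l ord0 ord0) p \in category_hom k.+1 l.
Proof.
apply: category_hom_relabel => [||i]; [exact: move_upK|exact: move_downK|].
rewrite /partition_word !big_ord_recl /= unlift_none.
under [X in _ * (_ * X)^-1]eq_bigr do rewrite liftK.
set a := i _; set u := \prod_(_ < k) _; set v := \prod_(_ < l) _ => H.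
apply: (@conj_gen a); rewrite !mulgA genK mul1g.
by rewrite invgM gen_inv !mulgA in H.
Qed.

Lemma category_hom_rot_right_up k l p : p \in category_hom k l.+1 ->
  relabel (@move_up k l ord_max ord_max) p \in category_hom k.+1 l.
Proof.
apply: category_hom_relabel => [||i]; [exact: move_upK|exact: move_downK|].
rewrite /partition_word !(big_ord_recr_lift (_ \o _)) /= unlift_none.
under [X in _ * (X * _)^-1]eq_bigr do rewrite liftK.
by rewrite invgM gen_inv mulgA.
Qed.

Lemma category_hom_pair : [set [set: points 2 0]] \in category_hom 2 0.
Proof.
apply/category_homP; split; first exact: partition_setT (inl ord0).
move=> i ip; rewrite /partition_word big_ord0 !big_ord_recl big_ord0 /=.
rewrite (ip setT (inl (lift ord0 ord0)) (inl ord0)) ?inE //.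
by rewrite mulg1 genK invg1 mulg1.
Qed.

Definition group_category : category_of_partitions :=
  CategoryOfPartitions category_hom_sub category_hom_tensor category_hom_compose
    category_hom_involution category_hom_rot_left_down category_hom_rot_right_down
    category_hom_rot_left_up category_hom_rot_right_up category_hom_pair.

(** Every compatible labelling spells aab above and baa below, and both equal b. *)
Lemma pi0_group_category : pi0 \in group_category 3 3.
Proof.
apply/category_homP; rewrite pi0_kernel; split; first exact: preim_partitionP.
move=> i /compatible_kernel[phi iE]; rewrite /partition_word.
rewrite !big_ord_recl !big_ord0 !iE /= !mulg1.
by rewrite genK mulg1 mulgA genK mul1g mulgV.
Qed.

Lemma F_inf_group_category : sS_invariant (nsg_pred N) ->
  F_inf_subgroup group_category = N.
Proof.
move=> Ninv; apply: normal_subgroup_inj; apply/funext => u; apply/idP/idP.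
  move=> /F_infP[k [p [i [/category_homP[pP pN] ip ->]]]].
  by have := pN i ip; rewrite /partition_word big_ord0 invg1 mulg1.
(* The partition joins equal letters of the reduced word of [u]. Its compatible labellings spell the
   images [sS_endo phi u], which lie in [N] by invariance. *)
move=> uN; apply/F_infP; pose L := @labelling (word u) [::] (size (word u)) 0.
exists (size (word u)), (kernel_partition L), L; split.
- apply/category_homP; split; first exact: preim_partitionP.
  move=> i /compatible_kernel[phi iE].
  have := Ninv phi u uN; rewrite [X in sS_endo _ X]Z2inf_prod -label_word_nth.
  rewrite sS_endo_label_word (eq_partition_word iE) /partition_word.
  by rewrite big_ord0 invg1 mulg1.
- by apply/compatible_kernel; exists id.
- by rewrite label_word_nth -Z2inf_prod.
Qed.

End GroupTheoreticalCategory.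

(** * Sets of words closed under the category operations *)

Definition subst_letter (y x z : nat) := if z == y then x else z.

Lemma subst_letter_notin y x s : y \notin s -> map (subst_letter y x) s = s.
Proof.
move=> ys; rewrite -[RHS]map_id; apply/eq_in_map => z zs; rewrite /subst_letter.
by case: eqP => // zy; rewrite -zy zs in ys.
Qed.

Lemma subst_letter_id y s : map (subst_letter y y) s = s.
Proof.
by rewrite -[RHS]map_id; apply/eq_map => z; rewrite /subst_letter; case: eqP.
Qed.

Lemma subst_letterl y x : subst_letter y x y = x.
Proof. by rewrite /subst_letter eqxx. Qed.

Lemma subst_letterr y x : subst_letter y x x = x.
Proof. by rewrite /subst_letter; case: eqP. Qed.

Lemma fresh_letter (s : seq nat) : exists c, c \notin s.
Proof.
exists (\max_(i <- s) i).+1; apply/negP => /(@leq_bigmax_seq _ s xpredT id).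
by move=> /(_ isT); rewrite ltnn.
Qed.

Section WordClosure.
(** [S] stands for the words of the one-row partitions in a category. The hypotheses reflect, in
    this order, independence of the chosen letters, rotation, tensor product, composition with a
    cup, the pair partition and [pi0]. *)
Variable S : seq nat -> Prop.
Hypothesis closed_inj : forall f (s : seq nat), {in s &, injective f} -> S s -> S (map f s).
Hypothesis closed_rcons : forall a s, S (a :: s) -> S (rcons s a).
Hypothesis closed_cat : forall s t : seq nat,
  ~~ has (fun x => x \in s) t -> S s -> S t -> S (s ++ t).
Hypothesis closed_contract : forall x y s, S [:: x, y & s] -> S (map (subst_letter y x) s).
Hypothesis closed_pair : forall a, S [:: a; a].
Hypothesis closed_pi0 : S [:: 0; 0; 1%N; 0; 0; 1%N].

Lemma closed_rot u v : S (u ++ v) -> S (v ++ u).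
Proof.
elim: u v => [|a u IH] v; first by rewrite cats0.
by move/closed_rcons; rewrite -cats1 -catA => /IH; rewrite -catA.
Qed.

Lemma closed_contract_in u x y v :
  S (u ++ [:: x, y & v]) -> S (map (subst_letter y x) (u ++ v)).
Proof.
by move/closed_rot/closed_contract; rewrite !map_cat => /closed_rot.
Qed.

Lemma closed_delete u a v : S (u ++ [:: a, a & v]) -> S (u ++ v).
Proof. by move/closed_contract_in; rewrite subst_letter_id. Qed.

Lemma closed_four c : S [:: c; c; c; c].
Proof.
apply: (@closed_inj (fun=> c) [:: 1; 1; 1; 1]%N) => [x y|].
  by rewrite !inE => /or4P[]/eqP-> /or4P[]/eqP->.
(* Contracting the two middle letters 1, 0 of 001001 turns 0 into 1 and leaves 1111. *)
exact: (@closed_contract_in [:: 0; 0] 1 0 [:: 0; 1]%N).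
Qed.

(** Append a fresh block cccc to the rotated word ending in [a]; contracting this [a] with the first
    c turns the remaining ccc into aaa. *)
Lemma closed_triple a s : S (a :: s) -> S [:: a, a, a & s].
Proof.
move=> Ss; have [c c_as] := fresh_letter (a :: s).
have cs : c \notin s by case/norP: c_as.
apply: (@closed_rot s [:: a; a; a]).
have -> : s ++ [:: a; a; a] = map (subst_letter c a) (s ++ [:: c; c; c]).
  by rewrite map_cat subst_letter_notin //= subst_letterl.
apply: closed_contract_in; rewrite (catA s [:: a] [:: c; c; c; c]).
apply: closed_cat (closed_four c); last exact: (@closed_rot [:: a]).
by rewrite cats1 /= mem_rcons (negPf c_as).
Qed.

(* Two fresh letters [c] and [d]: in [ccdccd], the partition [pi0] read along
   its boundary, [d] is glued to [x] and [c] to [a]. *)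
Lemma closed_move_letter a x r : S [:: a, a, x & r] -> S [:: x, a, a & r].
Proof.
move=> Ss; have [c c_s] := fresh_letter [:: a, a, x & r].
have [d d_s] := fresh_letter [:: c, a, a, x & r].
have dc : d == c = false by apply: contraNF d_s => /eqP->; rewrite inE eqxx.
have Scd : S [:: d; c; c; d; c; c].
  apply: (@closed_rot [:: c; c] [:: d; c; c; d]).
  pose f n := if n == 0 then c else d.
  have -> : [:: c; c] ++ [:: d; c; c; d] = map f [:: 0; 0; 1; 0; 0; 1]%N by [].
  apply: closed_inj closed_pi0 => m n.
  rewrite !inE => m01 n01.
  case: m m01 => [|[|//]] _; case: n n01 => [|[|//]] _ //= /eqP;
    by rewrite ?dc // eq_sym dc.
move: c_s d_s; rewrite !inE !negb_or => /and4P[ca _ cx cr] /and5P[_ da _ dx dr].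
(* Up to rotation the words run through r aax dccdcc, then r aacc x cc, then r aa x aa; deleting the
   first aa leaves r xaa. *)
apply: (@closed_rot r [:: x; a; a]); apply: (@closed_delete r a [:: x; a; a]).
have: S (map (subst_letter d x) ((r ++ [:: a; a]) ++ [:: c; c; d; c; c])).
  apply: closed_contract_in; rewrite -[_ ++ _]/((r ++ [:: a; a]) ++ [:: x] ++ _) catA.
  apply: closed_cat Scd; last by rewrite -catA; apply: (@closed_rot [:: a; a; x]).
  rewrite /= !mem_cat !inE !(negPf ca, negPf cx, negPf cr).
  by rewrite !(negPf da, negPf dx, negPf dr).
rewrite map_cat subst_letter_notin; last first.
  by rewrite mem_cat !inE !(negPf da, negPf dr).
rewrite /= subst_letterl /subst_letter [c == d]eq_sym dc -catA.
move=> H; have := @closed_contract_in (r ++ [:: a]) a c [:: c; x; c; c].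
rewrite -!catA => /(_ H); rewrite map_cat (subst_letter_notin _ cr) /=.
by rewrite subst_letterl subst_letterr /subst_letter [x == c]eq_sym (negPf cx).
Qed.

(** Once the pair has passed a letter, that letter is rotated to the far end, so that the pair is
    again at the head for the induction. *)
Lemma closed_move_pair a v r : S [:: a, a & v ++ r] -> S (v ++ [:: a, a & r]).
Proof.
elim: v r => [//|x v IH] r /closed_move_letter Sx.
have := @closed_rot [:: x] [:: a, a & v ++ r] Sx; rewrite -/cat /= -catA.
by move/IH; rewrite -!cat_cons catA => /closed_rot.
Qed.

(** Write the word as a v b w. Tripling [a] and moving the new pair up to [b] gives a v aa b w;
    contracting the last of these a's with [b] merges the blocks, and the other one takes the place
    of [b]. *)
Lemma closed_merge_head a b s : b \in s ->
  S (a :: s) -> S (map (subst_letter b a) (a :: s)).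
Proof.
case/splitPr=> v w /closed_triple/(@closed_move_pair a (a :: v) (b :: w)).
rewrite -[_ ++ _]/((a :: v) ++ [:: a] ++ [:: a, b & w]) catA => /closed_contract_in.
rewrite -[in X in _ -> X]cat_cons !map_cat /= subst_letterl subst_letterr -!catA.
by [].
Qed.

Lemma closed_merge a b s : a \in s -> b \in s -> a != b ->
  S s -> S (map (subst_letter b a) s).
Proof.
case/splitPr=> u v; rewrite mem_cat inE => b_s ab /closed_rot Ss.
rewrite map_cat; apply: closed_rot; rewrite -map_cat.
apply: (@closed_merge_head a b (v ++ u)) Ss; rewrite mem_cat orbC.
by rewrite [b == a]eq_sym (negPf ab) in b_s.
Qed.

(** Induction on the number of distinct letters: if [f] identifies two of them, merging these first
    leaves the image under [f] unchanged and uses up one letter. *)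
Lemma closed_map f s : S s -> S (map f s).
Proof.
elim: {s}_.+1 {-2}s (ltnSn (size (undup s))) => // n IH s s_n Ss.
have [f_inj|f_ninj] := EM {in s &, injective f}; first exact: closed_inj.
have [a [b [a_s b_s ab fab]]] : exists a b, [/\ a \in s, b \in s, a != b & f a = f b].
  apply: contra_notP f_ninj => no_pair a b a_s b_s fab.
  by apply: contra_notP no_pair => /eqP ab; exists a, b.
have -> : map f s = map f (map (subst_letter b a) s).
  rewrite -map_comp; apply: eq_map => z /=; rewrite /subst_letter.
  by case: eqP => // ->.
apply: IH; last exact: closed_merge.
rewrite ltnS in s_n; apply: leq_trans s_n.
(* The letter [b] is gone from the merged word, all of whose letters occur in [s]. *)
have : uniq (b :: undup (map (subst_letter b a) s)).
  rewrite /= undup_uniq andbT mem_undup; apply/mapP => -[z _].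
  rewrite /subst_letter; case: (eqVneq z b) => [_ /eqP|zb /eqP].
    by rewrite eq_sym (negPf ab).
  by rewrite eq_sym (negPf zb).
move/uniq_leq_size; apply => z; rewrite inE !mem_undup => /predU1P[-> //|].
by case/mapP=> y ys ->; rewrite /subst_letter; case: eqP.
Qed.

(** A fresh pair cc can be appended by [closed_cat]. Renaming c to [a], which may already occur,
    needs the full strength of [closed_map]. *)
Lemma closed_insert u a v : S (u ++ v) -> S (u ++ [:: a, a & v]).
Proof.
move/closed_rot=> Ss; have [c c_s] := fresh_letter (v ++ u).
have : S ((v ++ u) ++ [:: c; c]) by apply: closed_cat; rewrite //= (negPf c_s).
move/(closed_map (subst_letter c a)); rewrite map_cat subst_letter_notin //=.
by rewrite subst_letterl -catA => /closed_rot; rewrite -catA.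
Qed.

(** The fold reduces the word letter by letter from its right end, and each cancellation is a
    deletion that [closed_insert] undoes. So membership depends only on the element of the free
    product that is spelled. *)
Lemma closed_reduce s : S s <-> S (foldr push [::] s).
Proof.
suff red_in u : S (u ++ s) <-> S (u ++ foldr push [::] s) by exact: (red_in [::]).
elim: s u => [//|x s IH] u; rewrite -cat1s catA IH -catA /=.
case: (foldr push [::] s) => [//|y t] /=; case: eqP => [<-|//].
by split; [apply: closed_delete | apply: closed_insert].
Qed.

End WordClosure.

(** * Words of the partitions in a category *)

(** Keeping the row lengths separate from the lists avoids casts where a size is only provably equal
    to [k] or [l]. *)
Definition word_partition k l s t := kernel_partition (@labelling s t k l).

Lemma word_prod_gen (s : seq nat) : word (\prod_(a <- s) gen a) = foldr push [::] s.
Proof. by elim: s => [|a s IH]; rewrite ?big_nil // big_cons /= IH. Qed.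

Lemma kernel_word k (L : points k 0 -> nat) :
  kernel_partition L = word_partition k 0 [seq L (inl j) | j <- enum 'I_k] [::].
Proof.
have nthE (i : 'I_k) : nth 0 [seq L (inl j) | j <- enum 'I_k] i = L (inl i).
  by rewrite (nth_map i) ?size_enum_ord // nth_ord_enum.
by apply: eq_kernel_partition => -[i|[]//] [j|[]//]; rewrite -!nthE.
Qed.

Lemma size_labels k (L : points k 0 -> nat) :
  size [seq L (inl j) | j <- enum 'I_k] = k.
Proof. by rewrite size_map size_enum_ord. Qed.

Lemma label_word_enum k (i : points k 0 -> nat) :
  label_word i = \prod_(a <- [seq i (inl j) | j <- enum 'I_k]) gen a.
Proof. by rewrite big_map enumT /label_word [index_enum _]unlock. Qed.

Section CategoryWords.
Variable C : category_of_partitions.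

Lemma kernel_cat k l (L L' : points k l -> nat) : L =1 L' ->
  kernel_partition L \in C k l -> kernel_partition L' \in C k l.
Proof.
by move=> LL' LC; rewrite -(@eq_kernel_partition _ L) // => x y; rewrite !LL'.
Qed.

Lemma word_partition_rot_up k l s t a : size s = k -> size t = l ->
  word_partition k l.+1 s (rcons t a) \in C k l.+1 ->
  word_partition k.+1 l (rcons s a) t \in C k.+1 l.
Proof.
move=> sk tl /cat_rot_right_up.
rewrite (relabel_kernel _ (@move_upK _ _ _ _) (@move_downK _ _ _ _)).
apply: kernel_cat => -[i|j] /=; last first.
  by rewrite bump_ord nth_rcons tl ltn_ord.
rewrite nth_rcons sk; case: unliftP => [i' ->|->] /=.
  by rewrite bump_ord ltn_ord.
by rewrite nth_rcons tl ltnn !eqxx ltnn.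
Qed.

Lemma word_partition_rot_down k s a :
  word_partition k.+1 0 (a :: s) [::] \in C k.+1 0 ->
  word_partition k 1%N s [:: a] \in C k 1%N.
Proof.
move=> /cat_rot_left_down.
rewrite (relabel_kernel _ (@move_downK _ _ _ _) (@move_upK _ _ _ _)).
apply: kernel_cat => -[i|j] //=.
by rewrite !ord1 unlift_none.
Qed.

Lemma word_partition_tensor k l s t k' l' s' t' :
  size s = k -> size t = l -> size s' = k' -> size t' = l' ->
  (forall a, a \in s ++ t -> a \notin s' ++ t') ->
  word_partition k l s t \in C k l -> word_partition k' l' s' t' \in C k' l' ->
  word_partition (k + k') (l + l') (s ++ s') (t ++ t') \in C (k + k') (l + l').
Proof.
move=> sk tl sk' tl' dis pC qC.
have Ml x : labelling (s ++ s') (t ++ t') (tensorl k' l' x) = @labelling s t k l x.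
  by case: x => i /=; rewrite nth_cat ?sk ?tl ltn_ord.
have Mr x : labelling (s ++ s') (t ++ t') (tensorr k l x) = @labelling s' t' k' l' x.
  by case: x => i /=; rewrite nth_cat ?sk ?tl ltnNge leq_addr addKn.
rewrite /word_partition
  -(@tensor_kernel _ _ _ _ (@labelling s t k l) (@labelling s' t' k' l')).
- exact: cat_tensor.
- by move=> x y; rewrite !Ml.
- by move=> x y; rewrite !Mr.
move=> x y; rewrite Ml Mr.
have/dis: @labelling s t k l x \in s ++ t.
  by rewrite mem_cat; case: x => i /=; rewrite mem_nth ?orbT // ?sk ?tl.
apply: contraNneq => ->.
by rewrite mem_cat; case: y => i /=; rewrite mem_nth ?orbT // ?sk' ?tl'.
Qed.

Lemma word_partition_id m n : word_partition n n (iota m n) (iota m n) \in C n n.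
Proof.
elim: n m => [|n IH] m.
  (* The partition of no points arises by closing the pair partition with its own involution. *)
  have := cat_compose (cat_involution (cat_pair C)) (cat_pair C).
  set p := compose _ _ => pC.
  have : p \in partitions 0 0 by apply: (subsetP (cat_sub C 0 0)).
  rewrite inE => /partition_is_kernel[L pL]; rewrite pL in pC.
  by apply: kernel_cat pC => -[[]|[]].
apply: (@word_partition_tensor 1%N 1%N [:: m] [:: m]); rewrite ?size_iota //.
  move=> a; rewrite mem_cat !inE orbb => /eqP->.
  by rewrite mem_cat orbb mem_iota ltnn.
have := identity_cat C.
rewrite (@const_kernel_partition _ (inl ord0) (@labelling [:: m] [:: m] 1%N 1%N)) //.
by move=> [x|x] [y|y]; rewrite !ord1.
Qed.

(** A pair in the lower row to the left of [n] through strings: placed above a partition of [n.+2]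
    upper points, it joins the first two of them and removes them. *)
Lemma word_partition_cup n :
  word_partition n n.+2 (iota 1%N n) [:: 0, 0 & iota 1%N n] \in C n n.+2.
Proof.
apply: (@word_partition_tensor 0 2 [::] [:: 0; 0] n n); rewrite ?size_iota //.
- move=> a; rewrite !inE orbb => /eqP->.
  by rewrite mem_cat orbb mem_iota.
- have := cat_involution (cat_pair C).
  rewrite (@const_kernel_partition _ (inl ord0) (fun=> 0)) //.
  rewrite /involution (relabel_kernel _ (@flipK _ _) (@flipK _ _)).
  apply: kernel_cat => -[[]//|j].
  by case: j => [[|[|]]].
- exact: word_partition_id.
Qed.

(* The two middle points capped by the cup link the blocks of [x] and [y]. *)
Lemma word_partition_contract n x y s : size s = n ->
  word_partition n.+2 0 [:: x, y & s] [::] \in C n.+2 0 ->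
  word_partition n 0 (map (subst_letter y x) s) [::] \in C n 0.
Proof.
move=> sn qC; have := cat_compose (word_partition_cup n) qC.
rewrite compose_kernel.
set p := word_partition n _ _ _; set q := word_partition _ 0 _ _ => pqC.
rewrite /word_partition
  -(@eq_kernel_partition _ (stack_component p q \o @stack_outer n n.+2 0)) // => a b.
rewrite stack_componentE.
pose f := subst_letter y x; pose w := [:: x, y & s].
pose mid j : stack n n.+2 0 := inl (inr j).
have same (j j' : 'I_n.+2) : nth 0 w j = nth 0 w j' ->
    connect (stack_rel p q) (mid j) (mid j').
  move=> e; apply/connect1/(@stack_rel_bot _ _ _ p q (inl j) (inl j')).
  by rewrite same_block_kernel; apply/eqP.
have cup : connect (stack_rel p q) (mid ord0) (mid (lift ord0 ord0)).
  apply/connect1/(@stack_rel_top _ _ _ p q (inr ord0) (inr (lift ord0 ord0))).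
  by rewrite same_block_kernel.
have up i : connect (stack_rel p q) (inl (inl i)) (mid (rshift 2 i)).
  apply/connect1/(@stack_rel_top _ _ _ p q (inl i) (inr (rshift 2 i))).
  by rewrite same_block_kernel.
have sym := stack_connect_sym p q.
have toxy (j : 'I_n.+2) : (nth 0 w j == x) || (nth 0 w j == y) ->
    connect (stack_rel p q) (mid j) (mid ord0).
  case/orP => /eqP e; first exact: same.
  by apply: connect_trans (same _ (lift ord0 ord0) e) _; rewrite sym.
have fE z : (f z == x) = (z == x) || (z == y).
  by rewrite /f /subst_letter; case: (z == y); rewrite ?orbT ?eqxx ?orbF.
(* Either both letters are among [x] and [y], whose blocks the cup joins, or they were equal before
   the substitution. *)
have merged (j j' : 'I_n.+2) : f (nth 0 w j) = f (nth 0 w j') ->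
    connect (stack_rel p q) (mid j) (mid j').
  move=> e; case xy: ((nth 0 w j == x) || (nth 0 w j == y)).
    apply: connect_trans (toxy _ xy) _; rewrite sym; apply: toxy.
    by rewrite -fE -e fE.
  have := xy; rewrite -fE e fE; move: xy e; rewrite /f /subst_letter.
  by move=> /norP[_ /negPf->] e /norP[_ /negPf ej]; rewrite ej in e; apply: same.
case: a b => [a|[]//] [b|[]//] /=; rewrite !(nth_map 0) ?sn //.
apply/idP/eqP => [|e]; last first.
  apply: connect_trans (up a) _; rewrite sym; apply: connect_trans (up b) _.
  by apply: merged.
(* For the converse, this labelling by substituted letters is constant on the components. *)
pose i (z : stack n n.+2 0) := match z with
  | inl (inl j) => f (nth 0 s j) | inl (inr j) => f (nth 0 w j) | inr _ => 0 end.
apply: (@stack_connect_compatible _ _ _ p q i); apply/compatible_kernel.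
  (* The string labelled [m] ends at position [m.+1] of [w]. The cup has label 0 and is sent to the
     letter at position 1, namely [y], which [f] maps to [x] just like the letter at position 0. *)
  exists (fun m => f (nth 0 w m.+1)) => -[j|[[|[|j]] ltj]] /=.
  - by rewrite nth_iota.
  - by rewrite /f subst_letterl subst_letterr.
  - by [].
  - by rewrite nth_iota.
by exists f => -[j|[]].
Qed.

Definition in_category s := word_partition (size s) 0 s [::] \in C (size s) 0.

Lemma in_categoryE k s : size s = k ->
  in_category s = (word_partition k 0 s [::] \in C k 0).
Proof. by move=> <-. Qed.

Lemma in_category_inj f (s : seq nat) :
  {in s &, injective f} -> in_category s -> in_category (map f s).
Proof.
move=> f_inj; rewrite (in_categoryE (size_map f s)) /in_category /word_partition.
rewrite
  (@eq_kernel_partition _ (@labelling s [::] _ 0) (@labelling (map f s) [::] _ 0)) //.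
by move=> [i|[]//] [j|[]//] /=; rewrite !(nth_map 0) // (inj_in_eq f_inj) ?mem_nth.
Qed.

Lemma in_category_rcons a s : in_category (a :: s) -> in_category (rcons s a).
Proof.
move/word_partition_rot_down/(@word_partition_rot_up _ 0 s [::] a erefl erefl).
by rewrite -in_categoryE ?size_rcons.
Qed.

Lemma in_category_cat s t : ~~ has (fun x => x \in s) t ->
  in_category s -> in_category t -> in_category (s ++ t).
Proof.
move=> /hasPn st sC tC; rewrite (in_categoryE (size_cat s t)).
apply: (@word_partition_tensor _ 0 s [::] _ 0 t [::]) => // a; rewrite !cats0.
by apply: contraL => /st.
Qed.

Lemma in_category_contract x y s :
  in_category [:: x, y & s] -> in_category (map (subst_letter y x) s).
Proof.
by move/(word_partition_contract erefl); rewrite -in_categoryE ?size_map.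
Qed.

Lemma in_category_pair a : in_category [:: a; a].
Proof.
have := cat_pair C.
rewrite (@const_kernel_partition _ (inl ord0) (@labelling [:: a; a] [::] 2 0)) //.
by move=> [[[|[|//]] ?]|[]//] [[[|[|//]] ?]|[]//].
Qed.

Hypothesis pi0_C : pi0 \in C 3 3.

(** Rotating the lower row baa up from its right end appends its letters in reverse order, as
    aab. *)
Lemma in_category_pi0 : in_category [:: 0; 0; 1%N; 0; 0; 1%N].
Proof.
move: pi0_C; rewrite pi0_kernel.
move/(@word_partition_rot_up 3 2 [:: 0; 0; 1%N] [:: 1%N; 0] 0 erefl erefl).
move/(@word_partition_rot_up 4 1 [:: 0; 0; 1%N; 0] [:: 1%N] 0 erefl erefl).
exact: (@word_partition_rot_up 5 0 [:: 0; 0; 1%N; 0; 0] [::] 1 erefl erefl).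
Qed.

Lemma in_category_map f s : in_category s -> in_category (map f s).
Proof.
exact: (closed_map in_category_inj in_category_rcons in_category_cat
  in_category_contract in_category_pi0).
Qed.

Lemma in_category_reduce s : in_category s <-> in_category (foldr push [::] s).
Proof.
exact: (closed_reduce in_category_inj in_category_rcons in_category_cat
  in_category_contract in_category_pair in_category_pi0).
Qed.

(** A witness for membership in [F_inf] may spell the element by a different word and may give
    several blocks the same letter. Reduction takes care of the first, closure under [map] of the
    second. *)
Lemma in_category_F_inf s : in_category s <-> \prod_(a <- s) gen a \in F_inf C.
Proof.
split=> [sC|/F_infP[k [p [i [pC ip]]]]].
  apply/F_infP; exists (size s), (word_partition (size s) 0 s [::]).
  exists (@labelling s [::] _ 0); split=> //; last by rewrite label_word_nth.
  by apply/compatible_kernel; exists id.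
have : p \in partitions k 0 by apply: (subsetP (cat_sub C k 0)).
rewrite inE => /partition_is_kernel[L pL]; rewrite {p}pL in pC ip.
case/compatible_kernel: ip => phi iE.
rewrite label_word_enum => /(congr1 word); rewrite !word_prod_gen => s_red.
rewrite in_category_reduce s_red -in_category_reduce.
have -> : [seq i (inl j) | j <- enum 'I_k] =
    map phi [seq L (inl j) | j <- enum 'I_k].
  by rewrite -map_comp; apply: eq_map => j; rewrite iE.
apply: in_category_map; rewrite (in_categoryE (size_labels L)).
by rewrite -kernel_word.
Qed.

(** Recovers the one-row partitions of [C] from [F_inf C] alone, which is the core of
    injectivity. *)
Lemma F_inf_hom0 k p : p \in C k 0 <-> exists2 L : points k 0 -> nat,
  p = kernel_partition L & label_word L \in F_inf C.
Proof.
have LC (L : points k 0 -> nat) :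
    kernel_partition L \in C k 0 <-> label_word L \in F_inf C.
  rewrite label_word_enum -in_category_F_inf kernel_word.
  by rewrite (in_categoryE (size_labels L)).
split=> [pC|[L -> /LC]] //.
have : p \in partitions k 0 by apply: (subsetP (cat_sub C k 0)).
by rewrite inE => /partition_is_kernel[L pL]; exists L; rewrite ?pL // -LC -pL.
Qed.

End CategoryWords.

(** * The correspondence *)

Lemma category_eq (C C' : category_of_partitions) :
  (forall k p, p \in C k 0 <-> p \in C' k 0) -> C = C'.
Proof.
(* Rotating the rightmost lower point up is reversible inside a category, so induction on the length
   of the lower row reduces to one-row partitions. *)
move=> CC'; have {}CC' k l p : p \in C k l <-> p \in C' k l.
  elim: l k p => [|l IH] k p; first exact: CC'.
  have upC (D : category_of_partitions) :
      p \in D k l.+1 <-> relabel (@move_up k l ord_max ord_max) p \in D k.+1 l.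
    split; first exact: cat_rot_right_up.
    by move/cat_rot_right_down; rewrite (relabelK (@move_upK _ _ _ _)).
  rewrite !upC; exact: IH.
case: C C' CC' => [h ? ? ? ? ? ? ? ? ?] [h' ? ? ? ? ? ? ? ? ?] /= hh'.
have eqh : h = h'.
  apply: functional_extensionality_dep => k.
  apply: functional_extensionality_dep => l.
  by apply/setP => p; apply/idP/idP => /hh'.
by subst h'; congr CategoryOfPartitions; apply: Prop_irrelevance.
Qed.

Lemma F_inf_inj (C C' : category_of_partitions) : pi0 \in C 3 3 -> pi0 \in C' 3 3 ->
  F_inf C =i F_inf C' -> C = C'.
Proof.
move=> piC piC' FF'; apply: category_eq => k p.
rewrite !F_inf_hom0 //; split=> -[L pL Lw]; exists L => //.
  by rewrite -FF'.
by rewrite FF'.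
Qed.

Lemma F_inf_sS_invariant C : sS_invariant (F_inf C).
Proof.
move=> phi u /F_infP[k [p [i [pC ip ->]]]]; apply/F_infP.
exists k, p, (phi \o i); split=> //; last exact: sS_endo_label_word.
by move=> B x y Bp xB yB /=; rewrite (ip B x y).
Qed.

Lemma marked_iso_refl G : marked_iso G G.
Proof. by exists id; split=> //; exists id. Qed.

(** The right-hand side depends on [G] only, so normal subgroups whose quotients are isomorphic to
    the same marked group have the same elements. *)
Lemma marked_iso_kernel (G : marked_group) (N : normal_subgroup Z2inf) :
  marked_iso G (Z2inf_quotient N) ->
  forall u, (u \in nsg_pred N) = (\prod_(a <- word u) mg_gen G a == 1).
Proof.
case=> f [[g fK gK] fM f_gen] u.
have f1 : f 1 = 1 by apply: (@mulgI _ (f 1)); rewrite -fM !mulg1.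
have f_prod s : f (\prod_(a <- s) mg_gen G a) = quotient_map N (\prod_(a <- s) gen a).
  elim: s => [|a s IH]; first by rewrite !big_nil.
  by rewrite !big_cons fM IH f_gen quotient_mapM.
have uE : (u \in nsg_pred N) <-> quotient_map N 1 = quotient_map N u.
  by rewrite quotient_mapE invg1 mul1g.
move: (f_prod (word u)); rewrite -Z2inf_prod => f_u.
apply/idP/eqP => [/uE u1|u1].
  by apply: (can_inj fK); rewrite f_u f1 -u1.
by apply/uE; rewrite -f_u u1 f1.
Qed.

Theorem theorem4p6 :
  (forall C : category_of_partitions, pi0 \in C 3 3 ->
     strongly_symmetric_reflection_group (Z2inf_quotient (F_inf_subgroup C))) /\
  (forall G : marked_group, strongly_symmetric_reflection_group G ->
     exists! C : category_of_partitions,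
       pi0 \in C 3 3 /\ marked_iso G (Z2inf_quotient (F_inf_subgroup C))).
Proof.
split=> [C _|G [N [Ninv GN]]].
  by exists (F_inf_subgroup C); split; [exact: F_inf_sS_invariant|exact: marked_iso_refl].
exists (group_category N); split.
  by split; [exact: pi0_group_category | rewrite F_inf_group_category].
move=> C [piC GC]; apply: F_inf_inj => //; first exact: pi0_group_category.
(* Both subgroups consist of the elements that become trivial in [G]. *)
move=> u; rewrite (marked_iso_kernel GC).
by rewrite -(marked_iso_kernel GN) -{2}(F_inf_group_category Ninv).
Qed.
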